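(* Let $(X,d)$ be an honest metric space and let $p\in[1,\infty)$. For each $r\in\mathbb{R}$, the group $H_1\operatorname{Loc}_J\overline{N}_{+_p}(X)(r)$ is freely generated by the ordered pairs $(a,b)$ of distinct points of $X$ such that (1) $d(a,b)=r$, and (2) there is no $p$-interpolating point between $a$ and $b$.
   Context: $\mathbb{R}$ denotes the poset of extended nonnegative reals $0\le r\le\infty$ with the reverse of the usual order; $\mathbb{R}^{\mathrm{op}}$ has the usual order $\le$. An honest metric space is a metric space in the classical sense: $d:X\times X\to[0,\infty)$ positive definite, symmetric, satisfying the triangle inequality. Write $X(a,b)=d(a,b)$. Given distinct points $a,b\in X$, a point $c\in X$ $p$-interpolates between $a$ and $b$ when $a\ne c\ne b$ and there exist $r,s\in\mathbb{R}$ with $d(a,c)\le r$, $d(c,b)\le s$ and $(r^p+s^p)^{1/p}=d(a,b)$. Write $r+_ps=(r^p+s^p)^{1/p}$. The $\ell^p$ nerve $N_{+_p}(X)$ is the functor from $\mathbb{R}^{\mathrm{op}}$ to simplicial sets for which $N_{+_p}(X)(r)_n$ is the set of tuples $(x_0,\dots,x_n)$ of points for which there exist $r_1,\dots,r_n\in[0,\infty]$ with $r_1+_p\cdots+_pr_n\le r$ and $X(x_i,x_j)\le r_{i+1}+_p\cdots+_pr_j$ for all $0\le i\le j\le n$ (empty sums are $0$). Faces omit and degeneracies repeat a vertex; $r\le s$ acts by inclusion. $\overline{N}_{+_p}(X):\mathbb{R}^{\mathrm{op}}\to\mathbf{sAb}$ (simplicial abelian groups) is obtained by applying the free abelian group functor.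 For $A:\mathbb{R}^{\mathrm{op}}\to\mathbf{sAb}$, $\operatorname{Loc}_J(A)(r)=A(r)/A(J_r)$, where $J_r=\{s:s<r\}$ and $A(J_r)$ is the union of the images of $A(s)\to A(r)$ over $s<r$ (zero if $r=0$). $H_1$ is the first homology of the normalized Moore complex (degree $n$: $A_n$ modulo the subgroup generated by degenerate elements; differential the alternating sum of faces), taken pointwise in $r$. ''Freely generated by the pairs $(a,b)$'' means that the homology classes of the $1$-chains $(a,b)$ form a $\mathbb{Z}$-basis. *)

(* Defs.v *)
From HB Require Import structures.
From mathcomp Require Import all_boot all_order all_algebra.
From mathcomp Require Import generic_quotient ring_quotient.
From mathcomp Require Import boolp classical_sets.
From mathcomp Require Import reals constructive_ereal interval_inference.
From mathcomp Require Import topology exp.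
From mathcomp.multinomials Require Import freeg.
From mathcomp Require Import zify lra.

Set Implicit Arguments.
Unset Strict Implicit.
Unset Printing Implicit Defensive.

Import Order.TTheory GRing.Theory Num.Theory.

Local Open Scope ring_scope.
Local Open Scope quotient_scope.
Local Open Scope classical_set_scope.

Notation "{ 'quot' I }" := (Quotient.quot I) : type_scope.

Section QuotMap.
Variables (U V : zmodType) (I : zmodClosed U) (J : zmodClosed V).
Variable f : {additive U -> V}.

Definition quot_map of (forall x, x \in I -> f x \in J) :=
  fun x : {quot I} => \pi_({quot J}) (f (repr x)).

Hypothesis fIJ : forall x, x \in I -> f x \in J.

Lemma quot_mapE x : quot_map fIJ (\pi_({quot I}) x) = \pi_({quot J}) (f x).
Proof.
apply/eqP; rewrite -Quotient.idealrBE -raddfB; apply: fIJ.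
by rewrite Quotient.idealrBE reprK.
Qed.

Lemma quot_map_is_zmod_morphism : zmod_morphism (quot_map fIJ).
Proof.
move=> x y; rewrite -[x]reprK -[y]reprK -raddfB !quot_mapE raddfB.
by rewrite [LHS]raddfB.
Qed.
HB.instance Definition _ := GRing.isZmodMorphism.Build _ _ (quot_map fIJ)
  quot_map_is_zmod_morphism.
End QuotMap.

Section Span.
Variables (V : zmodType) (S : set V).

Definition zspan : {pred V} := fun x =>
  `[< smallest [set B : set V | B 0 /\ forall u v, B u -> B v -> B (u - v)]
      S x >].

Lemma zspan_is_zmod_closed : zmod_closed zspan.
Proof.
split; first by apply/asboolP => B [[B0 _] _].
move=> x y /asboolP Sx /asboolP Sy; apply/asboolP => B BS.
by have [[_ BB] _] := BS; apply: BB; [exact: Sx|exact: Sy].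
Qed.
HB.instance Definition _ := GRing.isZmodClosed.Build _ zspan zspan_is_zmod_closed.

Lemma mem_zspan x : S x -> x \in zspan.
Proof. by move=> Sx; apply/asboolP => B [_]; exact. Qed.

Lemma zspan_ind (W : zmodType) (J : zmodClosed W) (f : {additive V -> W}) :
  (forall x, S x -> f x \in J) -> forall x, x \in zspan -> f x \in J.
Proof.
move=> SJ x /asboolP /(_ [set u | f u \in J]); apply; split=> //=.
by split=> [|u v]; rewrite ?raddf0 ?rpred0// raddfB; exact: rpredB.
Qed.
End Span.

Definition monotone m n (f : {ffun 'I_m.+1 -> 'I_n.+1}) : bool :=
  [forall i : 'I_m.+1, forall j : 'I_m.+1, (i <= j)%N ==> (f i <= f j)%N].

Record delta m n := Delta {
  delta_fun :> {ffun 'I_m.+1 -> 'I_n.+1};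
  _ : monotone delta_fun }.

HB.instance Definition _ m n := [isSub for @delta_fun m n].

Lemma deltaP m n (f : delta m n) (i j : 'I_m.+1) : (i <= j)%N -> (f i <= f j)%N.
Proof. by case: f => f /= /forallP/(_ i)/forallP/(_ j)/implyP; apply. Qed.

Lemma delta_eq m n (f g : delta m n) : f =1 g -> f = g.
Proof. by move=> fg; apply/val_inj/ffunP. Qed.

Section MkDelta.
Variables (m n : nat) (f : 'I_m.+1 -> 'I_n.+1).
Hypothesis f_mono : forall i j : 'I_m.+1, (i <= j)%N -> (f i <= f j)%N.

Lemma mk_delta_subproof : monotone (finfun f).
Proof.
by apply/forallP => i; apply/forallP => j; apply/implyP; rewrite !ffunE; exact: f_mono.
Qed.
Definition mk_delta : delta m n := Delta mk_delta_subproof.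
End MkDelta.

Definition delta_id n : delta n n := mk_delta (fun i j (ij : (i <= j)%N) => ij).

Definition delta_comp l m n (g : delta m n) (f : delta l m) : delta l n :=
  mk_delta (fun i j ij => deltaP g (deltaP f ij)).

Lemma coface_subproof n (i : 'I_n.+2) (j k : 'I_n.+1) :
  (j <= k)%N -> (fintype.lift i j <= fintype.lift i k)%N.
Proof. by rewrite /= leq_bump2. Qed.

Definition coface n (i : 'I_n.+2) : delta n n.+1 :=
  mk_delta (@coface_subproof n i).

Lemma codegen_ord_subproof n (i : 'I_n.+1) (k : 'I_n.+2) :
  (unbump i k < n.+1)%N.
Proof. by rewrite /unbump; have := ltn_ord i; have := ltn_ord k; lia. Qed.

Lemma codegen_subproof n (i : 'I_n.+1) (j k : 'I_n.+2) : (j <= k)%N ->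
  (Ordinal (codegen_ord_subproof i j) <= Ordinal (codegen_ord_subproof i k))%N.
Proof. by rewrite /= /unbump; lia. Qed.

Definition codegen n (i : 'I_n.+1) : delta n.+1 n :=
  mk_delta (@codegen_subproof n i).

Lemma codegen_coface_id n (i : 'I_n.+2) (j : 'I_n.+1) :
  (i == j :> nat) || (i == j.+1 :> nat) ->
  delta_comp (codegen j) (coface i) = delta_id n.
Proof.
move=> ij; apply: delta_eq => k; rewrite !ffunE; apply: val_inj => /=.
have jn := ltn_ord j; have k_n := ltn_ord k.
by move: ij; rewrite /unbump /bump; lia.
Qed.

Lemma codegen_coface n (i : 'I_n.+3) (j : 'I_n.+2) :
  ~~ ((i == j :> nat) || (i == j.+1 :> nat)) ->
  exists (i' : 'I_n.+2) (j' : 'I_n.+1),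
    delta_comp (codegen j) (coface i) = delta_comp (coface i') (codegen j').
Proof.
rewrite negb_or => /andP[/eqP ij /eqP ij1].
have jn := ltn_ord j; have i_n := ltn_ord i.
have i'n : ((if i < j then nat_of_ord i else i.-1) < n.+2)%N by case: (ltnP i j); lia.
have j'n : ((if i < j then j.-1 else nat_of_ord j) < n.+1)%N by case: (ltnP i j); lia.
exists (Ordinal i'n), (Ordinal j'n); apply: delta_eq => k.
rewrite !ffunE; apply: val_inj => /=; rewrite /unbump /bump.
by case: (ltnP i j) => h; have := ltn_ord k; lia.
Qed.

Lemma coface_coface n (i : 'I_n.+2) (j : 'I_n.+3) (i' : 'I_n.+3) (j' : 'I_n.+2) :
  (i < j)%N -> i' = i :> nat -> j' = j.-1 :> nat ->
  delta_comp (coface j) (coface i) = delta_comp (coface i') (coface j').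
Proof.
move=> ij i'E j'E; apply: delta_eq => k; rewrite !ffunE; apply: val_inj => /=.
by rewrite i'E j'E /bump; lia.
Qed.

(* The sets of simplices are required to be choice types in order to form the
   free abelian groups on them; classically every type is one. *)
Record sSet := MkSSet {
  sset_obj :> nat -> choiceType;
  sset_act : forall m n, delta m n -> sset_obj n -> sset_obj m;
  sset_act_id : forall n x, sset_act (delta_id n) x = x;
  sset_act_comp : forall l m n (g : delta m n) (f : delta l m) x,
    sset_act (delta_comp g f) x = sset_act f (sset_act g x) }.

Record sSet_hom (A B : sSet) := MkSSetHom {
  sset_hom :> forall n, A n -> B n;
  sset_hom_nat : forall m n (f : delta m n) x,
    @sset_hom m (sset_act f x) = sset_act f (@sset_hom n x) }.

Record sAb := MkSAb {
  sab_obj :> nat -> zmodType;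
  sab_act : forall m n, delta m n -> {additive sab_obj n -> sab_obj m};
  sab_act_id : forall n x, sab_act (delta_id n) x = x;
  sab_act_comp : forall l m n (g : delta m n) (f : delta l m) x,
    sab_act (delta_comp g f) x = sab_act f (sab_act g x) }.

Record sAb_hom (A B : sAb) := MkSAbHom {
  sab_hom :> forall n, {additive A n -> B n};
  sab_hom_nat : forall m n (f : delta m n) x,
    sab_hom m (sab_act A f x) = sab_act B f (sab_hom n x) }.

(* Functors from a poset, with an arrow r -> s when r <= s.  On {nonneg \bar R}
   this is the usual order of [0, +oo], i.e. the opposite of the poset of
   extended nonnegative reals ordered by >=. *)
Record sSet_functor d (P : porderType d) := MkSSetFunctor {
  ssetF_obj :> P -> sSet;
  ssetF_mor : forall r s, (r <= s)%O -> sSet_hom (ssetF_obj r) (ssetF_obj s);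
  ssetF_id : forall r (rr : (r <= r)%O) n x, ssetF_mor rr n x = x;
  ssetF_comp : forall r s t (rs : (r <= s)%O) (st : (s <= t)%O) (rt : (r <= t)%O)
    n x, ssetF_mor rt n x = ssetF_mor st n (ssetF_mor rs n x) }.

Record sAb_functor d (P : porderType d) := MkSAbFunctor {
  sabF_obj :> P -> sAb;
  sabF_mor : forall r s, (r <= s)%O -> sAb_hom (sabF_obj r) (sabF_obj s);
  sabF_id : forall r (rr : (r <= r)%O) n x, sabF_mor rr n x = x;
  sabF_comp : forall r s t (rs : (r <= s)%O) (st : (s <= t)%O) (rt : (r <= t)%O)
    n x, sabF_mor rt n x = sabF_mor st n (sabF_mor rs n x) }.

Section FreeMap.
Variables (K L : choiceType) (f : K -> L).

Definition free_map : {freeg K / int} -> {freeg L / int} :=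
  fglift (fun k => << f k >>).

Lemma free_map_is_zmod_morphism : zmod_morphism free_map.
Proof. exact: lift_is_additive. Qed.
HB.instance Definition _ := GRing.isZmodMorphism.Build _ _ free_map
  free_map_is_zmod_morphism.

Lemma free_mapU k : free_map << k >> = << f k >>.
Proof. by rewrite /free_map liftU scale1r. Qed.
End FreeMap.

Lemma freeg_ext (K : choiceType) (V : zmodType) (f g : {additive {freeg K / int} -> V}) :
  (forall k, f << k >> = g << k >>) -> f =1 g.
Proof.
move=> fg D; rewrite -[D]freeg_sumE !raddf_sum; apply: eq_bigr => k _.
have -> : << coeff k D *g k >> = << k >> *~ coeff k D :> {freeg K / int}.
  by rewrite freeg_mulz intz.
by rewrite !raddfMz fg.
Qed.

Lemma free_map_id (K : choiceType) : @free_map K K id =1 id.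
Proof. by apply: (freeg_ext (f := @free_map K K id) (g := idfun)) => k; exact: free_mapU. Qed.

Lemma free_map_comp (K L M : choiceType) (g : L -> M) (f : K -> L) :
  free_map (g \o f) =1 free_map g \o free_map f.
Proof.
apply: (freeg_ext (f := free_map (g \o f)) (g := free_map g \o free_map f)) => k.
by rewrite [LHS]free_mapU /= !free_mapU.
Qed.

Section FreeSAb.
Variable A : sSet.
Let act m n (f : delta m n) : {additive {freeg (A n) / int} -> {freeg (A m) / int}} :=
  free_map (sset_act f).

Lemma free_sAb_id n x : act (delta_id n) x = x.
Proof.
rewrite -[RHS]free_map_id /act/=; congr (free_map _ _).
by apply/funext => y; rewrite sset_act_id.
Qed.

Lemma free_sAb_comp l m n (g : delta m n) (f : delta l m) x :
  act (delta_comp g f) x = act f (act g x).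
Proof.
rewrite /act/= -[RHS]/((free_map _ \o free_map _) x) -free_map_comp.
by congr (free_map _ _); apply/funext => y; rewrite /= sset_act_comp.
Qed.

Definition free_sAb : sAb := MkSAb free_sAb_id free_sAb_comp.
End FreeSAb.

Section FreeSAbHom.
Variables (A B : sSet) (h : sSet_hom A B).
Let hom n : {additive free_sAb A n -> free_sAb B n} := free_map (h n).

Lemma free_sAb_hom_nat m n (f : delta m n) x :
  hom m (sab_act _ f x) = sab_act _ f (hom n x).
Proof.
rewrite /hom/= -[LHS]/((free_map _ \o free_map _) x) -free_map_comp.
rewrite -[RHS]/((free_map _ \o free_map _) x) -free_map_comp.
by congr (free_map _ _); apply/funext => y; rewrite /= sset_hom_nat.
Qed.

Definition free_sAb_hom : sAb_hom (free_sAb A) (free_sAb B) :=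
  MkSAbHom free_sAb_hom_nat.
End FreeSAbHom.

Section FreeSAbFunctor.
Variables (d : Order.disp_t) (P : porderType d) (A : sSet_functor P).
Let mor r s (rs : (r <= s)%O) := free_sAb_hom (ssetF_mor A rs).

Lemma free_sAb_functor_id r (rr : (r <= r)%O) n x : mor rr n x = x.
Proof.
rewrite -[RHS]free_map_id /mor/=; congr (free_map _ _).
by apply/funext => y; rewrite ssetF_id.
Qed.

Lemma free_sAb_functor_comp r s t (rs : (r <= s)%O) (st : (s <= t)%O)
  (rt : (r <= t)%O) n x : mor rt n x = mor st n (mor rs n x).
Proof.
rewrite /mor/= -[RHS]/((free_map _ \o free_map _) x) -free_map_comp.
by congr (free_map _ _); apply/funext => y; rewrite /= (ssetF_comp rs st).
Qed.

Definition free_sAb_functor : sAb_functor P :=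
  MkSAbFunctor free_sAb_functor_id free_sAb_functor_comp.
End FreeSAbFunctor.

Section Loc.
Variables (R : realType) (A : sAb_functor {nonneg \bar R}) (r : {nonneg \bar R}).

(* The disjunct x = 0 only matters for r = 0, where J_r is empty. *)
Definition locJ_sub n : {pred A r n} := fun x =>
  `[< x = 0 \/ exists (s : {nonneg \bar R}) (sr : (s < r)%O) (y : A s n),
                 x = sabF_mor A (ltW sr) n y >].
Arguments locJ_sub : clear implicits.

Lemma locJ_sub_is_zmod_closed n : zmod_closed (locJ_sub n).
Proof.
have oppc x : x \in locJ_sub n -> - x \in locJ_sub n.
  move=> /asboolP[->|[s [sr [y ->]]]]; apply/asboolP; first by left; rewrite oppr0.
  by right; exists s, sr, (- y); rewrite raddfN.
have step (s : {nonneg \bar R}) (sr : (s < r)%O) (t : {nonneg \bar R}) (tr : (t < r)%O) (y : A s n) (z : A t n) :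
  (s <= t)%O -> sabF_mor A (ltW sr) n y - sabF_mor A (ltW tr) n z \in locJ_sub n.
  move=> st; apply/asboolP; right.
  by exists t, tr, (sabF_mor A st n y - z); rewrite raddfB -(sabF_comp st (ltW tr) (ltW sr)).
split; first by apply/asboolP; left.
move=> x y /[dup] xJ /asboolP[->|[s [sr [x' xE]]]] /[dup] yJ.
  by rewrite sub0r; exact: oppc.
move=> /asboolP[->|[t [tr [y' yE]]]]; first by rewrite subr0.
have [st|ts] := leP (s%:num) (t%:num); rewrite xE yE.
  exact: (step s sr t tr x' y' st).
by rewrite -opprB; apply: oppc; exact: (step t tr s sr y' x' (ltW ts)).
Qed.
HB.instance Definition _ n :=
  GRing.isZmodClosed.Build _ (locJ_sub n) (locJ_sub_is_zmod_closed n).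

Lemma locJ_act_subproof m n (f : delta m n) x :
  x \in locJ_sub n -> sab_act (A r) f x \in locJ_sub m.
Proof.
move=> /asboolP[->|[s [sr [y ->]]]]; apply/asboolP; first by left; rewrite raddf0.
by right; exists s, sr, (sab_act (A s) f y); rewrite sab_hom_nat.
Qed.

Let act m n (f : delta m n) : {additive {quot locJ_sub n} -> {quot locJ_sub m}} :=
  quot_map (I := locJ_sub n) (J := locJ_sub m) (@locJ_act_subproof m n f).

Lemma locJ_act_id n x : act (delta_id n) x = x.
Proof. by elim/quotW: x => x; rewrite /act/= quot_mapE sab_act_id. Qed.

Lemma locJ_act_comp l m n (g : delta m n) (f : delta l m) x :
  act (delta_comp g f) x = act f (act g x).
Proof.
elim/quotW: x => x.
have E k (h : delta k n) : act h (\pi_({quot locJ_sub n}) x) =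
  \pi_({quot locJ_sub k}) (sab_act (A r) h x) by exact: quot_mapE.
by rewrite !E sab_act_comp [RHS]quot_mapE.
Qed.

(* The value at r of the localization of A. *)
Definition LocJ : sAb := MkSAb locJ_act_id locJ_act_comp.

Definition LocJ_proj n : {additive A r n -> LocJ n} := \pi_({quot locJ_sub n}).
End Loc.

Record chainComplex := MkComplex {
  cc_obj :> nat -> zmodType;
  cc_d : forall n, {additive cc_obj n.+1 -> cc_obj n};
  cc_dd : forall n x, cc_d n (cc_d n.+1 x) = 0 }.

Section Homology.
Variables (C : chainComplex) (n : nat).

Definition is_cycle : {pred C n} :=
  match n return {pred C n} with
  | 0 => fun=> true
  | m.+1 => fun x => cc_d C m x == 0
  end.

Lemma is_cycle_zmod_closed : zmod_closed is_cycle.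
Proof.
rewrite /is_cycle; case: n => [|m]; split=> //; rewrite ?unfold_in ?raddf0//.
by move=> x y; rewrite !unfold_in raddfB => /eqP-> /eqP->; rewrite subr0.
Qed.
HB.instance Definition _ := GRing.isZmodClosed.Build _ is_cycle is_cycle_zmod_closed.

Record cycle := Cycle { cycle_val :> C n; cycleP : cycle_val \in is_cycle }.
HB.instance Definition _ := [isSub for cycle_val].
HB.instance Definition _ := [Choice of cycle by <:].
HB.instance Definition _ := [SubChoice_isSubZmodule of cycle by <:].

Definition is_boundary : {pred cycle} := fun z =>
  `[< exists w : C n.+1, cc_d C n w = cycle_val z >].

Lemma is_boundary_zmod_closed : zmod_closed is_boundary.
Proof.
split; first by apply/asboolP; exists 0; rewrite raddf0.
move=> x y /asboolP[u ux] /asboolP[v vy]; apply/asboolP; exists (u - v).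
by rewrite raddfB ux vy.
Qed.
HB.instance Definition _ :=
  GRing.isZmodClosed.Build _ is_boundary is_boundary_zmod_closed.

Definition homology : zmodType := {quot is_boundary}.

Definition homology_class (z : cycle) : homology := \pi_({quot is_boundary}) z.
End Homology.

Section Moore.
Variable A : sAb.

Definition degenerate n : set (A n) :=
  match n return set (A n) with
  | 0 => set0
  | m.+1 => [set x | exists (j : 'I_m.+1) (y : A m), x = sab_act A (codegen j) y]
  end.

Definition altsum n (x : A n.+1) : A n :=
  \sum_(i < n.+2) sab_act A (coface i) x *~ (-1) ^+ i.

Lemma altsum_is_zmod_morphism n : zmod_morphism (@altsum n).
Proof.
move=> x y; rewrite /altsum -sumrB; apply: eq_bigr => i _.
by rewrite raddfB mulrzBl.
Qed.
HB.instance Definition _ n :=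
  GRing.isZmodMorphism.Build _ _ (@altsum n) (@altsum_is_zmod_morphism n).

Lemma altsum_degenerate n x :
  x \in zspan (@degenerate n.+1) -> altsum x \in zspan (@degenerate n).
Proof.
move: x; apply: (zspan_ind (f := @altsum n)) => x [j [y ->]] /=.
have jn := ltn_ord j.
have j0 : (j < n.+2)%N by lia.
have j1 : (j.+1 < n.+2)%N by lia.
rewrite /altsum (bigD1 (Ordinal j0))//= (bigD1 (Ordinal j1)) /=; last first.
  by apply/eqP => /(congr1 val) /=; lia.
rewrite -!sab_act_comp !codegen_coface_id ?eqxx ?orbT// sab_act_id addrA.
rewrite exprS mulN1r mulrNz subrr add0r.
apply: rpred_sum => i /andP[]; rewrite -!val_eqE /= => ij ij1.
apply: rpredMz; rewrite -sab_act_comp.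
case: n x i j y jn j0 j1 ij ij1 => [|n] _ i j y jn _ _ ij ij1.
  by have := ltn_ord i; lia.
have [|i' [j' ->]] := @codegen_coface n i j; first by rewrite negb_or ij ij1.
by rewrite sab_act_comp; apply: mem_zspan; exists j', (sab_act A (coface i') y).
Qed.

(* The normalized complex is the quotient by degeneracies, not the
   intersection of kernels of faces. *)
Definition moore_d n :
    {additive {quot zspan (@degenerate n.+1)} -> {quot zspan (@degenerate n)}} :=
  quot_map (I := zspan (@degenerate n.+1)) (J := zspan (@degenerate n)) (@altsum_degenerate n).

Lemma altsum_altsum n x : altsum (@altsum n.+1 x) = 0.
Proof.
pose F (ij : 'I_n.+2 * 'I_n.+3) : A n :=
  sab_act A (delta_comp (coface ij.2) (coface ij.1)) x *~ (-1) ^+ (ij.1 + ij.2).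
transitivity (\sum_ij F ij).
  rewrite -(pair_bigA _ (fun i j => F (i, j))) /altsum; apply: eq_bigr => i _.
  rewrite raddf_sum mulrz_suml; apply: eq_bigr => j _.
  by rewrite raddfMz -sab_act_comp -mulrzA -exprD addnC.
rewrite (bigID (fun ij : 'I_n.+2 * 'I_n.+3 => (ij.1 < ij.2)%N)) /=.
rewrite (reindex_onto (fun ij : 'I_n.+2 * 'I_n.+3 => (inord ij.2, inord ij.1.+1))
  (fun ij : 'I_n.+2 * 'I_n.+3 => (inord ij.2.-1, inord ij.1))) /=; last first.
  move=> [i j] /= ij; have := ltn_ord j => jn; congr pair; apply: val_inj => /=.
    by rewrite !inordK; lia.
  by rewrite !inordK; lia.
rewrite (eq_bigl (fun ij : 'I_n.+2 * 'I_n.+3 => ~~ (ij.1 < ij.2)%N)); last first.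
  move=> [i j] /=; have := ltn_ord j; have := ltn_ord i => i_n jn.
  rewrite xpair_eqE -!val_eqE /= [X in (_ < X)%N]inordK ?ltnS//.
  have [ij|ij] := ltnP i j => /=.
    by apply/negP => /andP[h /andP[_ /eqP]]; rewrite inordK; lia.
  by rewrite !inordK ?eqxx /=; lia.
rewrite -big_split /= big1// => -[i j] /=; rewrite -leqNgt => ij.
have := ltn_ord i => i_n; rewrite /F /=.
rewrite (@coface_coface _ (inord j) (inord i.+1) j i) ?inordK; try lia.
by rewrite addnS exprS mulN1r mulrNz addnC addNr.
Qed.

Lemma moore_dd n x : moore_d n (moore_d n.+1 x) = 0.
Proof.
elim/quotW: x => x; pose I k : zmodClosed (A k) := zspan (@degenerate k).
have E k (y : A k.+1) : moore_d k (\pi_({quot I k.+1}) y) = \pi_({quot I k}) (altsum y).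
  exact: quot_mapE.
by rewrite !E altsum_altsum raddf0.
Qed.

Definition moore : chainComplex := MkComplex moore_dd.

Definition moore_proj n : {additive A n -> moore n} :=
  \pi_({quot zspan (@degenerate n)}).
End Moore.

Section Nerve.
Variables (R : realType) (p : R).

(* Associative on [0, +oo] with neutral element 0, so that the iterated sums
   \big[addp/0] below do not depend on bracketing. *)
Definition addp (r s : \bar R) : \bar R := ((r `^ p + s `^ p) `^ p^-1)%E.

Definition p_interpolates (X : metricType R) (a b c : X) : Prop :=
  [/\ a <> c, c <> b &
   exists r s : \bar R, [/\ (0 <= r)%E, (0 <= s)%E,
     ((mdist a c)%:E <= r)%E, ((mdist c b)%:E <= s)%E &
     addp r s = (mdist a b)%:E]].

(* The r_1, ..., r_n are indexed from 0 here, so that the distance between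
   x_i and x_j is bounded by the sum of the t k with i <= k < j. *)
Definition in_nerve (X : metricType R) (r : {nonneg \bar R}) n
    (x : n.+1.-tuple X) : Prop :=
  exists t : 'I_n -> \bar R, [/\ forall k, (0 <= t k)%E,
    (\big[addp/0%E]_(k < n) t k <= r%:num)%E &
    forall i j : 'I_n.+1, (i <= j)%N ->
      ((mdist (tnth x i) (tnth x j))%:E
        <= \big[addp/0%E]_(k < n | (i <= k < j)%N) t k)%E].

Lemma addp_ge0 r s : (0 <= addp r s)%E.
Proof. exact: poweR_ge0. Qed.

Lemma big_addp_ge0 n (P : pred 'I_n) (F : 'I_n -> \bar R) :
  (0 <= \big[addp/0%E]_(k < n | P k) F k)%E.
Proof. by elim/big_rec: _ => // k x _ _; exact: addp_ge0. Qed.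

Hypothesis p_ge1 : 1 <= p.

Let p_gt0 : 0 < p. Proof. exact: lt_le_trans p_ge1. Qed.

Let poweRVK (x : \bar R) : (0 <= x)%E -> ((x `^ p^-1) `^ p)%E = x.
Proof. by move=> x0; rewrite -poweRrM mulVf ?gt_eqF// poweRe1. Qed.

Let poweRKV (x : \bar R) : (0 <= x)%E -> ((x `^ p) `^ p^-1)%E = x.
Proof. by move=> x0; rewrite -poweRrM mulfV ?gt_eqF// poweRe1. Qed.

Let lee_poweR (q : R) (x y : \bar R) : 0 < q -> (0 <= x)%E -> (x <= y)%E ->
  (x `^ q <= y `^ q)%E.
Proof.
move=> q0 x0 xy; apply: gt0_ler_poweR => //; rewrite ?ltW//.
all: by rewrite in_itv /= leey ?x0 ?(le_trans x0).
Qed.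

Let lee_poweR2 (x y : \bar R) : (0 <= x)%E -> (0 <= y)%E ->
  (x `^ p <= y `^ p)%E = (x <= y)%E.
Proof.
move=> x0 y0; apply/idP/idP => [xy|]; last exact: lee_poweR.
by rewrite -(poweRKV x0) -(poweRKV y0) lee_poweR ?invr_gt0 ?poweR_ge0.
Qed.

Lemma addp_poweR r s : (addp r s `^ p)%E = (r `^ p + s `^ p)%E.
Proof. by rewrite poweRVK// adde_ge0// poweR_ge0. Qed.

Lemma big_addp_poweR n (P : pred 'I_n) (F : 'I_n -> \bar R) :
  ((\big[addp/0%E]_(k < n | P k) F k) `^ p)%E = (\sum_(k < n | P k) F k `^ p)%E.
Proof.
elim/big_rec2: _ => [|k x y _ <-]; last by rewrite addp_poweR.
by rewrite poweR0r// gt_eqF.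
Qed.

Let sum_ord_nat m (u : nat -> \bar R) i j : (j <= m)%N ->
  (\sum_(k < m | (i <= k < j)%N) u k = \sum_(i <= k < j) u k)%E.
Proof.
move=> jm; rewrite -(big_mkord (fun k => i <= k < j)%N).
rewrite [RHS](big_nat_widenl i 0%N)// [RHS](big_nat_widen 0%N j m)//.
Qed.

Let sum_blocks m n (g : nat -> nat) (u : nat -> \bar R) i j :
  (i <= j <= m)%N -> (forall a b, (a <= b)%N -> (g a <= g b)%N) ->
  (forall a, (g a <= n)%N) ->
  (\sum_(k < m | (i <= k < j)%N) \sum_(l < n | (g k <= l < g k.+1)%N) u l
    = \sum_(l < n | (g i <= l < g j)%N) u l)%E.
Proof.
move=> /andP[ij jm] gmono gn.
rewrite (sum_ord_nat (fun k => \sum_(l < n | (g k <= l < g k.+1)%N) u l)%E)//.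
rewrite sum_ord_nat//.
under eq_bigr => k _ do rewrite sum_ord_nat//.
elim: j ij jm => [|j IH]; first by rewrite leqn0 => /eqP-> _; rewrite !big_geq.
rewrite leq_eqVlt => /predU1P[->|ij] jm; first by rewrite !big_geq.
rewrite big_nat_recr//= IH//; last exact: ltnW.
by rewrite -big_cat_nat//; exact: gmono.
Qed.

Variable X : metricType R.

Lemma in_nerve_act r m n (f : delta m n) (x : n.+1.-tuple X) :
  in_nerve r x -> in_nerve r [tuple tnth x (f i) | i < m.+1].
Proof.
move=> [t [t0 tr tx]].
pose g k := f (inord (minn k m)).
have g_mono a b : (a <= b)%N -> (g a <= g b)%N.
  by move=> ab; apply: deltaP; rewrite !inordK; lia.
pose u l := if insub l is Some k then (t k `^ p)%E else 0%E.
have uE (l : 'I_n) : u l = (t l `^ p)%E by rewrite /u valK.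
have u0 l : (0 <= u l)%E by rewrite /u; case: insub => // k; exact: poweR_ge0.
pose T (k : 'I_m) := \big[addp/0%E]_(l < n | (g k <= l < g k.+1)%N) t l.
have TE i j : (i <= j <= m)%N ->
  ((\big[addp/0%E]_(k < m | (i <= k < j)%N) T k) `^ p =
   (\big[addp/0%E]_(l < n | (g i <= l < g j)%N) t l) `^ p)%E.
  move=> ijm; rewrite !big_addp_poweR.
  under eq_bigr => k _ do rewrite big_addp_poweR.
  under eq_bigr => k _ do under eq_bigr => l _ do rewrite -uE.
  under [RHS]eq_bigr => k _ do rewrite -uE.
  by apply: (@sum_blocks m n g u i j) => // a; rewrite -ltnS.
exists T; split; first by move=> k; exact: big_addp_ge0.
  apply: le_trans tr; rewrite -lee_poweR2 ?big_addp_ge0//.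
  rewrite (eq_bigl (fun k : 'I_m => (0 <= k < m)%N)); last by move=> k; rewrite ltn_ord.
  rewrite TE ?leqnn// !big_addp_poweR [leRHS](bigID (fun l : 'I_n => (g 0%N <= l < g m)%N)) /=.
  by apply: leeDl; apply: sume_ge0 => l _; exact: poweR_ge0.
move=> i j ij; rewrite !tnth_mktuple.
apply: le_trans (tx _ _ (deltaP f ij)) _; rewrite -lee_poweR2 ?big_addp_ge0//.
have gE (k : 'I_m.+1) : g k = f k.
  by rewrite /g; congr (f _); apply: val_inj; rewrite /= inordK; have := ltn_ord k; lia.
have ijm : (i <= j <= m)%N by rewrite ij -ltnS ltn_ord.
by rewrite (TE _ _ ijm) !gE.
Qed.

Lemma in_nerve_le (r s : {nonneg \bar R}) n (x : n.+1.-tuple X) :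
  (r <= s)%O -> in_nerve r x -> in_nerve s x.
Proof.
move=> rs [t [t0 tr tx]]; exists t; split=> //.
by apply: (le_trans tr); exact: rs.
Qed.

Lemma in_nerve_edge (r : {nonneg \bar R}) (a b : X) :
  ((mdist a b)%:E <= r%:num)%E -> in_nerve r [tuple a; b].
Proof.
move=> abr; exists (fun=> (mdist a b)%:E); split=> [k||i j ij].
- by rewrite lee_fin mdist_ge0.
- apply: le_trans abr; rewrite -lee_poweR2 ?big_addp_ge0 ?lee_fin ?mdist_ge0//.
  by rewrite big_addp_poweR big_ord1.
- rewrite -lee_poweR2 ?big_addp_ge0 ?lee_fin ?mdist_ge0// big_addp_poweR.
  move: ij; rewrite leq_eqVlt => /predU1P[/val_inj ->|ij].
    by rewrite mdistxx poweR0r ?gt_eqF// sume_ge0// => k _; exact: poweR_ge0.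
  have i0 : i = ord0 by apply: val_inj => /=; have := ltn_ord j; lia.
  have j1 : j = ord_max by apply: val_inj => /=; have := ltn_ord j; lia.
  by rewrite i0 j1 (big_pred1 ord0)// => k; rewrite (ord1 k).
Qed.

Section NerveAt.
Variable r : {nonneg \bar R}.

Definition nerve_obj n : choiceType :=
  {x : n.+1.-tuple X | `[< in_nerve r x >]}.

Definition nerve_act m n (f : delta m n) (x : nerve_obj n) : nerve_obj m :=
  exist _ [tuple tnth (val x) (f i) | i < m.+1]
    (asboolT (in_nerve_act f (asboolW (valP x)))).

Lemma nerve_act_id n (x : nerve_obj n) : nerve_act (delta_id n) x = x.
Proof. by apply/val_inj/eq_from_tnth => i; rewrite /= tnth_mktuple ffunE. Qed.

Lemma nerve_act_comp l m n (g : delta m n) (f : delta l m) (x : nerve_obj n) :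
  nerve_act (delta_comp g f) x = nerve_act f (nerve_act g x).
Proof. by apply/val_inj/eq_from_tnth => i; rewrite /= !tnth_mktuple ffunE. Qed.

Definition nerve_sSet : sSet := MkSSet nerve_act_id nerve_act_comp.
End NerveAt.

Section NerveMor.
Variables (r s : {nonneg \bar R}) (rs : (r <= s)%O).

Definition nerve_incl n (x : nerve_sSet r n) : nerve_sSet s n :=
  exist _ (val x) (asboolT (in_nerve_le rs (asboolW (valP x)))).

Lemma nerve_incl_nat m n (f : delta m n) x :
  nerve_incl (sset_act f x) = sset_act f (nerve_incl x).
Proof. exact: val_inj. Qed.

Definition nerve_mor : sSet_hom (nerve_sSet r) (nerve_sSet s) :=
  MkSSetHom nerve_incl_nat.
End NerveMor.

Lemma nerve_mor_id r (rr : (r <= r)%O) n x : nerve_mor rr n x = x.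
Proof. exact: val_inj. Qed.

Lemma nerve_mor_comp r s t (rs : (r <= s)%O) (st : (s <= t)%O) (rt : (r <= t)%O)
  n x : nerve_mor rt n x = nerve_mor st n (nerve_mor rs n x).
Proof. exact: val_inj. Qed.

Definition lp_nerve : sSet_functor {nonneg \bar R} :=
  MkSSetFunctor nerve_mor_id nerve_mor_comp.

Definition lp_nerve_ab : sAb_functor {nonneg \bar R} := free_sAb_functor lp_nerve.
End Nerve.

Section Edges.
Variables (R : realType) (p : R) (p_ge1 : 1 <= p) (X : metricType R).
Variable r : {nonneg \bar R}.

Definition unfilled_pair : choiceType :=
  {ab : X * X | `[< [/\ ab.1 <> ab.2, (mdist ab.1 ab.2)%:E = r%:num &
                     ~ exists c, p_interpolates p ab.1 ab.2 c] >]}.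

Lemma unfilled_pair_in_nerve (e : unfilled_pair) :
  in_nerve p r [tuple (val e).1; (val e).2].
Proof.
by case: e => ab /= /asboolP[_ abr _]; apply: in_nerve_edge => //; rewrite abr.
Qed.

Definition edge (e : unfilled_pair) : lp_nerve p_ge1 X r 1%N :=
  exist _ [tuple (val e).1; (val e).2] (asboolT (unfilled_pair_in_nerve e)).

Definition edge_chain (e : unfilled_pair) :
    moore (LocJ (lp_nerve_ab p_ge1 X) r) 1%N :=
  moore_proj _ 1%N (LocJ_proj (lp_nerve_ab p_ge1 X) r 1%N << edge e >>).
End Edges.

Definition Zbasis (I : choiceType) (V : zmodType) (b : I -> V) : Prop :=
  (forall v, exists (s : seq I) (c : I -> int), v = \sum_(i <- s) b i *~ c i) /\
  (forall (s : seq I) (c : I -> int), uniq s ->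
    \sum_(i <- s) b i *~ c i = 0 -> forall i, i \in s -> c i = 0).

(* Main.v *)
(** For r > 0 the degree-0 part of the localization vanishes, and its degree-1
    part is generated by the pairs (a, b) with d(a, b) = r; for r = 0 only
    degenerate simplices remain.  In the boundary (c, b) - (a, b) + (a, c) of a
    nondegenerate 2-simplex (a, c, b) with r finite, the outer faces have length
    strictly less than r and vanish; what is left is a pair (a, b) which vanishes
    too unless d(a, b) = r, in which case c p-interpolates between a and b.
    Hence projecting onto the pairs without interpolating point kills all
    boundaries and induces an inverse to the map from the free group on these
    pairs to H_1. *)
Require Import Defs.
From HB Require Import structures.
From mathcomp Require Import all_boot all_order all_algebra.
From mathcomp Require Import generic_quotient ring_quotient.
From mathcomp Require Import boolp classical_sets.
From mathcomp Require Import reals constructive_ereal interval_inference topology.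
From mathcomp Require Import exp.
From mathcomp.multinomials Require Import freeg.

Set Implicit Arguments.
Unset Strict Implicit.
Unset Printing Implicit Defensive.

Import Order.TTheory GRing.Theory Num.Theory.

Local Open Scope ring_scope.
Local Open Scope quotient_scope.

(** * Universal properties of free abelian groups and of quotients *)

Section FreeLift.
Variables (K : choiceType) (V : zmodType) (f : K -> V).

(** [fglift] maps into modules over [int]; [zmodule V] is the abelian group [V] with its canonical
    module structure. *)
Definition free_lift : {freeg K / int} -> V := fglift (f : K -> zmodule V).

Lemma free_lift_is_zmod_morphism : zmod_morphism free_lift.
Proof. exact: (@lift_is_additive int K (zmodule V) f). Qed.
HB.instance Definition _ := GRing.isZmodMorphism.Build _ _ free_lift
  free_lift_is_zmod_morphism.

Lemma free_liftU k : free_lift << k >> = f k.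
Proof. by rewrite /free_lift liftU scale1r. Qed.

Lemma free_liftE D : free_lift D = \sum_(k <- dom D) f k *~ coeff k D.
Proof.
rewrite -{1}[D]freeg_sumE raddf_sum; apply: eq_bigr => k _.
exact: (@liftU int (zmodule V) K f).
Qed.
End FreeLift.

Section QuotLift.
Variables (U V : zmodType) (I : zmodClosed U) (f : {additive U -> V}).

Definition quot_lift of (forall x, x \in I -> f x = 0) :=
  fun x : {quot I} => f (repr x).

Hypothesis f0 : forall x, x \in I -> f x = 0.

(** The chosen representative differs from [x] by an element of [I], which [f] kills. *)
Lemma quot_liftE x : quot_lift f0 (\pi_({quot I}) x) = f x.
Proof.
apply/eqP; rewrite -subr_eq0 -raddfB; apply/eqP/f0.
by rewrite Quotient.idealrBE reprK.
Qed.

Lemma quot_lift_is_zmod_morphism : zmod_morphism (quot_lift f0).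
Proof.
by move=> x y; rewrite -[x]reprK -[y]reprK -raddfB !quot_liftE raddfB.
Qed.
HB.instance Definition _ := GRing.isZmodMorphism.Build _ _ (quot_lift f0)
  quot_lift_is_zmod_morphism.
End QuotLift.

Lemma quot_pi0 (U : zmodType) (I : zmodClosed U) x :
  x \in I -> \pi_({quot I}) x = 0.
Proof.
move=> xI; rewrite -[RHS](raddf0 (\pi_({quot I}))); apply/eqP.
by rewrite -Quotient.idealrBE subr0.
Qed.

Lemma zspan_kernel (V W : zmodType) (S : set V) (f : {additive V -> W}) :
  (forall x, S x -> f x = 0) -> forall x, x \in zspan S -> f x = 0.
Proof.
move=> S0 x /asboolP /(_ (fun u => f u = 0)); apply; split=> //=.
by split=> [|u v u0 v0]; rewrite ?raddf0// raddfB u0 v0 subr0.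
Qed.

(** [psi] is a two-sided inverse of [free_lift b]: the first hypothesis expresses every [v] in the
    [b i], the second turns a relation among the [b i] into one among free generators, whose
    coefficients vanish. *)
Lemma Zbasis_retract (I : choiceType) (V : zmodType) (b : I -> V)
    (psi : {additive V -> {freeg I / int}}) :
  (forall v, free_lift b (psi v) = v) -> (forall i, psi (b i) = << i >>) ->
  Zbasis b.
Proof.
move=> phiK psib; split=> [v|s c us].
  by exists (dom (psi v)), (fun i => coeff i (psi v)); rewrite -free_liftE phiK.
move=> /(congr1 psi); rewrite raddf0 raddf_sum => E i si.
have cE j : coeff i (psi (b j *~ c j)) = c j *+ (j == i).
  by rewrite raddfMz psib freeg_mulz coeffU intz mulr_natr.
have := congr1 (coeff i) E; rewrite coeff0 raddf_sum (bigD1_seq i)//=.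
rewrite big1 => [|j ji]; rewrite cE; first by rewrite eqxx addr0.
by rewrite (negbTE ji).
Qed.

(** * Computing in the localization and in the Moore complex *)

Lemma LocJ_act_proj (R : realType) (A : sAb_functor {nonneg \bar R}) r m n
    (f : delta m n) x :
  sab_act (LocJ A r) f (LocJ_proj A r n x) = LocJ_proj A r m (sab_act (A r) f x).
Proof. exact: quot_mapE. Qed.

Lemma altsum_LocJ_proj (R : realType) (A : sAb_functor {nonneg \bar R}) r n x :
  altsum (LocJ_proj A r n.+1 x) = LocJ_proj A r n (altsum x).
Proof.
rewrite /altsum raddf_sum; apply: eq_bigr => i _.
by rewrite LocJ_act_proj raddfMz.
Qed.

Lemma moore_d_proj (A : sAb) n x :
  cc_d (moore A) n (moore_proj A n.+1 x) = moore_proj A n (altsum x).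
Proof. exact: quot_mapE. Qed.

Lemma LocJ_proj_mor (R : realType) (A : sAb_functor {nonneg \bar R})
    (s r : {nonneg \bar R}) (sr : (s <= r)%O) n x :
  (s < r)%O -> LocJ_proj A r n (sabF_mor A sr n x) = 0.
Proof.
move=> lt_sr.
have xJ : sabF_mor A sr n x \in @locJ_sub R A r n.
  apply/asboolP; right.
  (* [locJ_sub] uses the particular proof [ltW lt_sr], whereas [sr] is arbitrary. *)
  by exists s, lt_sr, x; rewrite (bool_irrelevance sr (ltW lt_sr)).
exact: (quot_pi0 xJ).
Qed.

Lemma moore_proj_degenerate (A : sAb) n j x :
  moore_proj A n.+1 (sab_act A (codegen j) x) = 0.
Proof.
have xD : sab_act A (codegen j) x \in zspan (@degenerate A n.+1).
  by apply: mem_zspan; exists j, x.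
exact: (quot_pi0 xD).
Qed.

(** * Strict monotonicity of the sum $+_p$ *)

Section Addp.
Variables (R : realType) (p : R).
Hypothesis p_ge1 : 1 <= p.
Implicit Types r s : \bar R.

Let p_gt0 : 0 < p. Proof. exact: lt_le_trans p_ge1. Qed.

Lemma addpC r s : addp p r s = addp p s r.
Proof. by rewrite /addp addeC. Qed.

Lemma addpr0 r : (0 <= r)%E -> addp p r 0 = r.
Proof.
move=> r0; rewrite /addp poweR0r ?gt_eqF// adde0 -poweRrM.
by rewrite mulfV ?gt_eqF// poweRe1.
Qed.

(** Otherwise $r^p+s^p\le r^p$, which is impossible for $s>0$ and finite $r^p$. Finiteness is
    essential, since an infinite [r] absorbs [s]. *)
Lemma addp_gtl r s : (0 <= r)%E -> (0 < s)%E -> (addp p r s < +oo)%E ->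
  (r < addp p r s)%E.
Proof.
move=> r0 s0 rs_fin; rewrite ltNge; apply/negP => rs_le.
have : (addp p r s `^ p <= r `^ p)%E.
  by apply: gt0_ler_poweR; rewrite ?(ltW p_gt0)// in_itv /= leey ?r0 ?addp_ge0.
have := poweR_lty p rs_fin; rewrite addp_poweR// => sum_fin.
rewrite leNgt lteDl ?poweR_gt0//.
rewrite ge0_fin_numE ?poweR_ge0//; apply: le_lt_trans sum_fin.
by rewrite leeDl// poweR_ge0.
Qed.

End Addp.

Lemma index_enum_ord2 : index_enum 'I_2 = [:: 0; 1].
Proof.
rewrite [index_enum _]unlock -enumT enum_ordSl enum_ordSl.
rewrite (size0nil (size_enum_ord 0)).
by congr [:: _; _]; apply: val_inj.
Qed.

(** * Simplices of dimension at most two in the nerve *)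

Section InNerve.
Variables (R : realType) (p : R) (X : metricType R).
Hypothesis p_ge1 : 1 <= p.
Implicit Types r : {nonneg \bar R}.

Lemma in_nerve0 r (x : 1.-tuple X) : in_nerve p r x.
Proof.
exists (fun=> 0%E); split=> // [|i j _]; first by rewrite big_ord0 ge0e.
by rewrite !ord1 mdistxx big_ord0.
Qed.

Lemma in_nerve1P r (x : 2.-tuple X) : in_nerve p r x <->
  ((mdist (tnth x 0) (tnth x 1))%:E <= r%:num)%E.
Proof.
split=> [[t [_ tr /(_ 0 1 isT) tx]]|].
  apply: le_trans tr; apply: (le_trans tx).
  rewrite [X in (_ <= X)%E](eq_bigl (fun k : 'I_1 => (0 <= k < 1)%N))//.
  by move=> k; rewrite ltn_ord.
move=> xr.
have := in_nerve_edge p_ge1 xr; suff <- : x = [tuple tnth x 0; tnth x 1] by [].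
by apply: eq_from_tnth => -[[|[|//]] i]; congr tnth; apply: val_inj.
Qed.

(** The bounds [t0], [t1] are those of [p_interpolates]: for a triangle $(a,c,b)$ with $d(a,b)=r$
    the last two inequalities become the equality required there. *)
Lemma in_nerve2P r (x : 3.-tuple X) : in_nerve p r x <->
  exists t0 t1 : \bar R, [/\ (0 <= t0)%E, (0 <= t1)%E,
    ((mdist (tnth x 0) (tnth x 1))%:E <= t0)%E,
    ((mdist (tnth x 1) (tnth x 2))%:E <= t1)%E &
    ((mdist (tnth x 0) (tnth x 2))%:E <= addp p t0 t1 <= r%:num)%E].
Proof.
split=> [[t [t0 tr tx]]|[t0 [t1 [t00 t10 x01 x12 /andP[x02 tr]]]]].
  exists (t 0), (t 1); move: tr (tx 0 1 isT) (tx 1 2 isT) (tx 0 2 isT).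
  by rewrite index_enum_ord2 !big_cons !big_nil /= !addpr0// => -> -> -> ->.
exists (fun k => if k == 0 then t0 else t1); split.
- by move=> k; case: ifP.
- by rewrite index_enum_ord2 !big_cons big_nil /= addpr0.
(* This point serves as default value for [nth]. *)
have d : X := tnth x 0.
rewrite !(tnth_nth d)/= in x01 x12 x02.
move=> i j; rewrite index_enum_ord2 !big_cons big_nil /= !(tnth_nth d).
case: i j => -[|[|[|//]]] ? [[|[|[|//]]] ?] //= _.
all: by rewrite ?mdistxx ?addpr0.
Qed.
End InNerve.

(** * Simplices that vanish in the localization *)

Section FirstHomology.
Variables (R : realType) (p : R) (p_ge1 : 1 <= p) (X : metricType R).
Variable r : {nonneg \bar R}.

Local Notation N := (lp_nerve p_ge1 X).
Local Notation A := (lp_nerve_ab p_ge1 X).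
Local Notation L := (LocJ A r).
Local Notation C := (moore L).
Local Notation U := (unfilled_pair p X r).

Lemma chain_kernel s n (V : zmodType) (f : {additive A s n -> V}) :
  (forall k : N s n, f << k >> = 0) -> forall x, f x = 0.
Proof. by move=> f0 x; rewrite (freeg_ext (f := f) (g := \0)). Qed.

Lemma LocJ_proj_small (s : {nonneg \bar R}) n (x : N r n) :
  (s < r)%O -> in_nerve p s (val x) -> LocJ_proj A r n << x >> = 0.
Proof.
move=> sr xs; pose y : N s n := exist _ (val x) (asboolT xs).
rewrite -[RHS](LocJ_proj_mor (A := A) (ltW sr) (<< y >> : A s n) sr).
congr (LocJ_proj _ _ _ _).
by rewrite [RHS]free_mapU; congr << _ >>; exact: val_inj.
Qed.

Lemma LocJ_proj_vertex (x : N r 0%N) : (0 < r%:num)%E -> LocJ_proj A r 0%N << x >> = 0.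
Proof.
(* A single vertex is a simplex already at parameter $0<r$. *)
move=> r0; apply: (@LocJ_proj_small (0%:E)%:nng%E) => //.
exact: in_nerve0.
Qed.

Lemma LocJ_proj_short (x : N r 1%N) :
  ((mdist (tnth (val x) 0) (tnth (val x) 1))%:E < r%:num)%E ->
  LocJ_proj A r 1%N << x >> = 0.
Proof.
move=> xr; pose d := mdist (tnth (val x) 0) (tnth (val x) 1).
have d0 : 0 <= d by exact: mdist_ge0.
(* The length of the pair is the least parameter at which it is a simplex. *)
apply: (@LocJ_proj_small (NngNum d0)%:num%:E%:nng%E) => //.
by apply/in_nerve1P.
Qed.

(** * Faces and boundaries of edges and triangles *)

Lemma tnth_face n (i : 'I_n.+2) (x : N r n.+1) k :
  tnth (val (sset_act (coface i) x)) k = tnth (val x) (fintype.lift i k).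
Proof. by rewrite tnth_mktuple ffunE. Qed.

Lemma altsumU n (x : N r n.+1) : altsum (A := A r) (<< x >> : A r n.+1) =
  \sum_(i < n.+2) << sset_act (coface i) x >> *~ (-1) ^+ i.
Proof. by apply: eq_bigr => i _; rewrite [sab_act _ _ _]free_mapU. Qed.

Lemma altsum1 (x : N r 1%N) : altsum (A := A r) (<< x >> : A r 1%N) =
  << sset_act (coface 0) x >> - << sset_act (coface 1) x >>.
Proof.
rewrite altsumU !big_ord_recl big_ord0 addr0 /= mulr1z /bump/= expr1 mulrN1z.
by congr (_ - << nerve_act _ (coface _) _ >>); apply: val_inj.
Qed.

Lemma altsum2 (x : N r 2%N) : altsum (A := A r) (<< x >> : A r 2%N) =
  << sset_act (coface 0) x >> - << sset_act (coface 1) x >>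
    + << sset_act (coface 2) x >>.
Proof.
rewrite altsumU !big_ord_recl big_ord0 addr0 /= mulr1z /bump/= expr1 mulrN1z.
rewrite sqrrN expr1n mulr1z addrA.
by congr (_ - << nerve_act _ (coface _) _ >> + << nerve_act _ (coface _) _ >>);
  apply: val_inj.
Qed.

Lemma face2_vertices (x : N r 2%N) :
  [/\ tnth (val (sset_act (coface 0) x)) 0 = tnth (val x) 1,
      tnth (val (sset_act (coface 0) x)) 1 = tnth (val x) 2,
      tnth (val (sset_act (coface 1) x)) 0 = tnth (val x) 0,
      tnth (val (sset_act (coface 1) x)) 1 = tnth (val x) 2 &
      tnth (val (sset_act (coface 2) x)) 0 = tnth (val x) 0 /\
      tnth (val (sset_act (coface 2) x)) 1 = tnth (val x) 1].
Proof.
by split; [| | | |split]; rewrite tnth_face; congr tnth; apply: val_inj.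
Qed.

(** Since $t_1$ is positive and the sum finite, $d(x_0,x_1)\le t_0<t_0+_pt_1\le r$. *)
Lemma in_nerve2_gtl (x : 3.-tuple X) : in_nerve p r x -> (r%:num < +oo)%E ->
  tnth x 1 != tnth x 2 -> ((mdist (tnth x 0) (tnth x 1))%:E < r%:num)%E.
Proof.
move=> /(in_nerve2P p_ge1)[t0 [t1 [t00 t10 x01 x12 /andP[_ tr]]]] roo x1x2.
have t_fin := le_lt_trans tr roo.
apply: le_lt_trans x01 _; apply: lt_le_trans tr.
apply: addp_gtl => //.
by apply: lt_le_trans x12; rewrite lte_fin mdist_gt0.
Qed.

Lemma in_nerve2_gtr (x : 3.-tuple X) : in_nerve p r x -> (r%:num < +oo)%E ->
  tnth x 0 != tnth x 1 -> ((mdist (tnth x 1) (tnth x 2))%:E < r%:num)%E.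
Proof.
move=> /(in_nerve2P p_ge1)[t0 [t1 [t00 t10 x01 x12 /andP[_ tr]]]] roo x0x1.
have t_fin := le_lt_trans tr roo.
apply: le_lt_trans x12 _; apply: lt_le_trans tr.
rewrite addpC in t_fin *; apply: addp_gtl => //.
by apply: lt_le_trans x01; rewrite lte_fin mdist_gt0.
Qed.

(** * The projection onto the pairs without interpolating point *)

Definition unfilled_class (a b : X) : {freeg U / int} :=
  if (insub (a, b) : option U) is Some e then << e >> else 0.

Lemma unfilled_class0 a b : ~ [/\ a <> b, (mdist a b)%:E = r%:num &
  ~ exists c, p_interpolates p a b c] -> unfilled_class a b = 0.
Proof. by move=> ab; rewrite /unfilled_class insubF//; exact/asboolF. Qed.

Lemma unfilled_class_short a b :
  ((mdist a b)%:E < r%:num)%E -> unfilled_class a b = 0.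
Proof. by move=> ab; apply: unfilled_class0 => -[_ E _]; rewrite E ltxx in ab. Qed.

Lemma unfilled_classxx a : unfilled_class a a = 0.
Proof. by apply: unfilled_class0 => -[]. Qed.

(** This map is to descend in turn to [L], to [C] and to homology; the lemmas that follow show that
    it kills what each quotient divides out. *)
Definition unfilled_part : {additive A r 1%N -> {freeg U / int}} :=
  free_lift (fun x : N r 1%N => unfilled_class (tnth (val x) 0) (tnth (val x) 1)).

Lemma unfilled_partU (x : N r 1%N) :
  unfilled_part << x >> = unfilled_class (tnth (val x) 0) (tnth (val x) 1).
Proof. exact: free_liftU. Qed.

Lemma unfilled_part_edge (e : U) : unfilled_part << edge p_ge1 e >> = << e >>.
Proof. by rewrite unfilled_partU /unfilled_class/= -surjective_pairing valK. Qed.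

Lemma unfilled_part_locJ x : x \in @locJ_sub R A r 1 -> unfilled_part x = 0.
Proof.
move=> /asboolP[->|[s [sr [y ->]]]]; first exact: raddf0.
apply: (chain_kernel (f := unfilled_part \o sabF_mor A (ltW sr) 1%N)) => k /=.
rewrite [free_map _ _]free_mapU unfilled_partU unfilled_class_short//.
(* A pair from an earlier stage [s] has length at most $s<r$. *)
apply: (@le_lt_trans _ _ s%:num%E); last exact: sr.
apply/(in_nerve1P p_ge1).
exact: (asboolW (valP k)).
Qed.

Definition unfilled_part_loc : {additive L 1%N -> {freeg U / int}} :=
  quot_lift unfilled_part_locJ.

Lemma unfilled_part_locE x : unfilled_part_loc (LocJ_proj A r 1%N x) = unfilled_part x.
Proof. exact: quot_liftE. Qed.

Lemma unfilled_part_loc_degenerate x :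
  x \in zspan (@degenerate L 1) -> unfilled_part_loc x = 0.
Proof.
apply: zspan_kernel => _ [j [y ->]]; elim/quotW: y => y.
rewrite [sab_act _ _ _](LocJ_act_proj (A := A)) unfilled_part_locE.
apply: (chain_kernel (f := unfilled_part \o sab_act (A r) (codegen j))) => k /=.
rewrite [free_map _ _]free_mapU unfilled_partU !tnth_mktuple.
by rewrite !ffunE !ord1 unfilled_classxx.
Qed.

Definition unfilled_part_moore : {additive C 1%N -> {freeg U / int}} :=
  quot_lift unfilled_part_loc_degenerate.

Lemma unfilled_part_mooreE x :
  unfilled_part_moore (moore_proj L 1%N x) = unfilled_part_loc x.
Proof. exact: quot_liftE. Qed.

Lemma unfilled_part_altsum x : unfilled_part (altsum (A := A r) (n := 1) x) = 0.
Proof.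
apply: (chain_kernel (f := unfilled_part \o @altsum (A r) 1)) => k /=.
rewrite altsum2 raddfD raddfB !unfilled_partU.
have [-> -> -> -> [-> ->]] := face2_vertices k.
have kN : in_nerve p r (val k) := asboolW (valP k).
set a := tnth _ 0; set c := tnth _ 1; set b := tnth _ 2.
(* If [c] is one of the endpoints, two faces coincide with opposite signs and the third is
   constant. *)
have [ac|ac] := eqVneq a c; first by rewrite ac unfilled_classxx subrr addr0.
have [cb|cb] := eqVneq c b; first by rewrite -cb unfilled_classxx sub0r addNr.
have [roo|roo] := ltP (r%:num)%E +oo%E; last first.
  (* For infinite [r] no pair has length [r], so the projection is zero. *)
  suff unf0 u v : unfilled_class u v = 0 by rewrite !unf0 subr0 addr0.
  by apply: unfilled_class0 => -[_ E _]; rewrite -E leye_eq in roo.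
rewrite (unfilled_class_short (in_nerve2_gtr kN roo ac)).
rewrite (unfilled_class_short (in_nerve2_gtl kN roo cb)).
rewrite unfilled_class0 ?subr0 ?addr0// => -[ab abr]; apply.
have /(in_nerve2P p_ge1)[t0 [t1 [t00 t10 x01 x12 /andP[x02 tr]]]] := kN.
exists c; split; [exact/eqP|exact/eqP|exists t0, t1; split=> //].
(* Equality is forced by $d(a,b)\le t_0+_pt_1\le r=d(a,b)$. *)
by apply/eqP; rewrite eq_le x02 andbT [leRHS]abr.
Qed.

Lemma unfilled_part_moore_d w : unfilled_part_moore (cc_d C 1 w) = 0.
Proof.
(* The first elimination lifts [w] from the normalized quotient, the second from the localization,
   to a chain on triangles. *)
elim/quotW: w => w; elim/quotW: w => w.
rewrite [cc_d _ _ _](moore_d_proj (A := L)) unfilled_part_mooreE.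
by rewrite [altsum _](altsum_LocJ_proj (A := A)) unfilled_part_locE unfilled_part_altsum.
Qed.

(** * Homology classes of 1-chains *)

Lemma chain1_cycle (x : C 1%N) : x \in @is_cycle C 1.
Proof.
apply/eqP; elim/quotW: x => x; elim/quotW: x => x.
rewrite [LHS](moore_d_proj (A := L)) [altsum _](altsum_LocJ_proj (A := A)).
apply: (chain_kernel
  (f := moore_proj L 0 \o LocJ_proj A r 0 \o @altsum (A r) 0)) => k /=.
rewrite altsum1 2!raddfB /=.
(* For $r>0$ both faces vanish; for $r=0$ the two endpoints coincide, so the faces are equal and
   cancel. *)
have [r0|r0] := ltP 0%E (r%:num)%E; first by rewrite !LocJ_proj_vertex// raddf0 subr0.
have kN : in_nerve p r (val k) := asboolW (valP k).
have k01 : tnth (val k) 0 = tnth (val k) 1.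
  apply: mdist_positivity; apply/eqP; rewrite eq_le mdist_ge0 andbT -lee_fin.
  by apply: le_trans r0; exact/(in_nerve1P p_ge1).
suff -> : nerve_act p_ge1 (coface 0) k = nerve_act p_ge1 (coface 1) k by rewrite subrr.
apply/val_inj/eq_from_tnth => i; rewrite !tnth_face ord1.
have -> : fintype.lift 0 0 = 1 :> 'I_2 by exact: val_inj.
have -> : fintype.lift 1 0 = 0 :> 'I_2 by exact: val_inj.
by rewrite k01.
Qed.

Definition class1 (x : C 1%N) : homology C 1 :=
  homology_class (Cycle (chain1_cycle x)).

Lemma class1_is_zmod_morphism : zmod_morphism class1.
Proof.
by move=> x y; rewrite /class1 /homology_class -raddfB; congr (\pi _); exact: val_inj.
Qed.
HB.instance Definition _ := GRing.isZmodMorphism.Build _ _ class1 class1_is_zmod_morphism.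

Definition class_of_chain : {additive A r 1%N -> homology C 1} :=
  class1 \o moore_proj L 1%N \o LocJ_proj A r 1%N.

Lemma class_of_chain_short (x : N r 1%N) :
  ((mdist (tnth (val x) 0) (tnth (val x) 1))%:E < r%:num)%E ->
  class_of_chain << x >> = 0.
Proof. by move=> xr; rewrite /class_of_chain /= LocJ_proj_short// !raddf0. Qed.

Lemma class1_eq0 x w : cc_d C 1 w = x -> class1 x = 0.
Proof.
move=> wx; have xB : Cycle (chain1_cycle x) \in @is_boundary C 1.
  by apply/asboolP; exists w.
exact: (quot_pi0 xB).
Qed.

Lemma class_of_chain_altsum x : class_of_chain (altsum (A := A r) (n := 1) x) = 0.
Proof.
apply: (@class1_eq0 _ (moore_proj L 2%N (LocJ_proj A r 2%N x))).
rewrite [LHS](moore_d_proj (A := L)); congr (moore_proj _ _ _).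
exact: (altsum_LocJ_proj (A := A)).
Qed.

Lemma edge_surj (x : N r 1%N) (a := tnth (val x) 0) (b := tnth (val x) 1) :
  [/\ a <> b, (mdist a b)%:E = r%:num & ~ exists c, p_interpolates p a b c] ->
  exists e : U, x = edge p_ge1 e.
Proof.
move=> abU; exists (exist _ (a, b) (asboolT abU)).
apply/val_inj/eq_from_tnth => -[[|[|//]] i] /=.
  by rewrite /a; congr tnth; apply: val_inj.
by rewrite /b; congr tnth; apply: val_inj.
Qed.

(** There are three cases: a pair with $a=b$ is degenerate, a pair shorter than [r] vanishes in the
    localization, and any other is, up to sign and vanishing outer faces, the boundary of a triangle
    through an interpolating point. *)
Lemma class_of_chain_unfilled0 (x : N r 1%N) (a := tnth (val x) 0) (b := tnth (val x) 1) :
  ~ [/\ a <> b, (mdist a b)%:E = r%:num & ~ exists c, p_interpolates p a b c] ->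
  class_of_chain << x >> = 0.
Proof.
move=> abU; have xN : in_nerve p r (val x) := asboolW (valP x).
have [ab|ab] := eqVneq a b.
  pose z : N r 0%N := exist _ [tuple a] (asboolT (in_nerve0 p r [tuple a])).
  have -> : x = sset_act (codegen 0) z.
    apply/val_inj/eq_from_tnth => i; rewrite tnth_mktuple ord1 [RHS]/=.
    case: i => -[|[|//]] i /=; rewrite -?ab; [rewrite /a|rewrite [RHS]ab /b].
      by congr tnth; apply: val_inj.
    by congr tnth; apply: val_inj.
  have E := LocJ_act_proj (A := A) (codegen (0 : 'I_1)) (<< z >> : A r 0%N).
  have D := moore_proj_degenerate (A := L) (0 : 'I_1) (LocJ_proj A r 0%N << z >>).
  rewrite E [sab_act _ _ _]free_mapU in D.
  by rewrite /class_of_chain /= D raddf0.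
have /(in_nerve1P p_ge1) := xN; rewrite le_eqVlt => /predU1P[abr|abr]; last first.
  exact: class_of_chain_short.
have [c [/eqP ac /eqP cb [t0 [t1 [t00 t10 ct0 ct1 tE]]]]]
  : exists c, p_interpolates p a b c.
  by apply: contrapT => abc; apply: abU; split=> //; exact/eqP.
have yN : in_nerve p r [tuple a; c; b].
  (* Interpolation gives $t_0+_pt_1=d(a,b)=r$, exactly the sum allowed in the nerve at [r]. *)
  by apply/(in_nerve2P p_ge1); exists t0, t1; split=> //; rewrite tE -abr !lexx.
pose y : N r 2%N := exist _ [tuple a; c; b] (asboolT yN).
have := class_of_chain_altsum << y >>; rewrite altsum2.
have roo : (r%:num < +oo)%E by rewrite -abr ltry.
have [y0 y1 _ _ [y2 y3]] := face2_vertices y.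
rewrite raddfD raddfB [X in X - _ + _]class_of_chain_short; last first.
  by rewrite y0 y1; exact: in_nerve2_gtr yN roo ac.
rewrite [X in _ + X]class_of_chain_short; last first.
  by rewrite y2 y3; exact: in_nerve2_gtl yN roo cb.
(* The outer faces being zero, the vanishing boundary is minus the class of the middle face. *)
rewrite sub0r addr0 => /eqP; rewrite oppr_eq0 => /eqP <-.
suff -> : x = sset_act (coface 1) y by [].
apply/val_inj/eq_from_tnth => i; rewrite tnth_face.
case: i => -[|[|//]] i /=.
  by rewrite [RHS](tnth_nth a)/= /a; congr tnth; apply: val_inj.
by rewrite [RHS](tnth_nth a)/= /b; congr tnth; apply: val_inj.
Qed.

(** * The inverse map on homology *)

Lemma unfilled_part_moore_cycle (x : Defs.cycle C 1) :
  x \in @is_boundary C 1 -> (unfilled_part_moore \o val) x = 0.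
Proof.
move=> /asboolP[w wx]; rewrite -[LHS]/(unfilled_part_moore (cycle_val x)) -wx.
exact: unfilled_part_moore_d.
Qed.

Definition unfilled_part_homology : {additive homology C 1 -> {freeg U / int}} :=
  quot_lift unfilled_part_moore_cycle.

Lemma unfilled_part_homologyE (x : C 1%N) :
  unfilled_part_homology (class1 x) = unfilled_part_moore x.
Proof. exact: quot_liftE. Qed.

Lemma unfilled_part_homology_edge (e : U) :
  unfilled_part_homology (class1 (edge_chain p_ge1 e)) = << e >>.
Proof.
rewrite unfilled_part_homologyE unfilled_part_mooreE unfilled_part_locE.
exact: unfilled_part_edge.
Qed.

(** Both sides are additive, so single 1-simplices suffice: one given by an unfilled pair returns to
    its own class, and any other has class zero by [class_of_chain_unfilled0]. *)
Lemma edge_class_unfilled_part v :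
  free_lift (fun e : U => class1 (edge_chain p_ge1 e)) (unfilled_part_homology v) = v.
Proof.
(* Replacing the proof of the cycle condition brings [v] into the form [class1 x]. *)
elim/quotW: v => -[x xC]; have -> : xC = chain1_cycle x by exact: bool_irrelevance.
move: x {xC}; elim/quotW => x; elim/quotW: x => x.
apply/eqP; rewrite -subr_eq0; apply/eqP.
pose phi : {additive {freeg U / int} -> homology C 1} :=
  free_lift (fun e : U => class1 (edge_chain p_ge1 e)).
apply: (chain_kernel
  (f := (phi \o unfilled_part_homology \o class_of_chain) \- class_of_chain))
  => k /=.
have [kU|kU] := pselect [/\ tnth (val k) 0 <> tnth (val k) 1,
    (mdist (tnth (val k) 0) (tnth (val k) 1))%:E = r%:num &
    ~ exists c, p_interpolates p (tnth (val k) 0) (tnth (val k) 1) c].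
  have [e ->] := edge_surj kU.
  pose v := class1 (edge_chain p_ge1 e).
  rewrite -[LHS]/(phi (unfilled_part_homology v) - v) unfilled_part_homology_edge.
  by rewrite [phi _]free_liftU subrr.
pose w := class_of_chain << k >>; rewrite -[LHS]/(phi (unfilled_part_homology w) - w).
by rewrite [w]class_of_chain_unfilled0// !raddf0 addr0.
Qed.
End FirstHomology.

Theorem proposition27 (R : realType) (X : metricType R) (p : R)
    (p_ge1 : (1 <= p)%R) (r : {nonneg \bar R}) :
  exists cyc : forall e : unfilled_pair p X r, edge_chain p_ge1 e \in @is_cycle _ 1,
    @Zbasis (unfilled_pair p X r)
      (homology (moore (LocJ (lp_nerve_ab p_ge1 X) r)) 1)
      (fun e => homology_class (Cycle (cyc e))).
Proof.
exists (fun e => chain1_cycle (edge_chain p_ge1 e)).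
apply: (Zbasis_retract (psi := unfilled_part_homology p_ge1 X r)).
- exact: edge_class_unfilled_part.
- exact: unfilled_part_homology_edge.
Qed.
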